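(* Let $N\geq 2$ and $k\in\{1,\dots,N-1\}$. Consider the problem $$\mathcal{P}^-_{k}(D^2u)+u-u^3=0\ \text{ in }\mathbb R^N,\qquad |u|<1\ \text{ in }\mathbb R^N. \tag{P}$$ The following hold. (i) If $u\in USC(\mathbb R^N)$ is a one dimensional viscosity subsolution of (P), then $u\geq 0$ in $\mathbb R^N$. (ii) The only classical one dimensional solution of (P) is $u\equiv 0$. (iii) There exist nontrivial one dimensional viscosity solutions $u(x)=v(x_N)$ of (P) satisfying $$\lim_{x_N\to-\infty}v(x_N)=0\quad\text{and}\quad \lim_{x_N\to+\infty}v(x_N)=1,$$ and there exist nontrivial one dimensional viscosity solutions $u(x)=v(x_N)$ of (P) satisfying $$\lim_{x_N\to\pm\infty}v(x_N)=1.$$ (iv) There are no positive one dimensional viscosity supersolutions of (P). (v) If $u\geq 0$, $u(x)=v(x_N)$, is a one dimensional viscosity supersolution of (P) and $u$ is nondecreasing in the $x_N$-direction, then there exists $t_0\in\mathbb R$ such that $u=0$ in $\{x\in\mathbb R^N:\ x_N\leq t_0\}$.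
   Context: For a real symmetric $N\times N$ matrix $X$ with ordered eigenvalues $\lambda_1(X)\leq\dots\leq\lambda_N(X)$, the truncated Laplacian is $\mathcal{P}^-_{k}(X)=\lambda_1(X)+\dots+\lambda_k(X)$. Points of $\mathbb R^N$ are written $x=(x_1,\dots,x_N)$. A function $u$ on $\mathbb R^N$ is one dimensional if $u(x)=v(x_N)$ for some $v:\mathbb R\to\mathbb R$. $USC(\mathbb R^N)$ denotes the upper semicontinuous functions on $\mathbb R^N$. Viscosity notions are the standard ones. A viscosity subsolution (resp. supersolution) of (P) is an upper (resp. lower) semicontinuous function $u:\mathbb R^N\to\mathbb R$ with $|u|<1$ such that, whenever $\varphi\in C^2$ touches $u$ from above (resp. below) at a point $\hat x$, that is, $u-\varphi$ has a local maximum (resp. minimum) at $\hat x$, one has $\mathcal{P}^-_{k}(D^2\varphi(\hat x))+u(\hat x)-u(\hat x)^3\geq 0$ (resp. $\leq 0$). The test functions $\varphi$ are functions of all $N$ variables and need not be one dimensional. A viscosity solution is a function that is both a viscosity subsolution and a viscosity supersolution. A classical solution is a $C^2$ function satisfying (P) pointwise. Positive means $u>0$ everywhere in $\mathbb R^N$. *)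

(* Defs.v *)
From HB Require Import structures.
From mathcomp Require Import all_boot all_order all_algebra.
From mathcomp Require Import all_classical all_reals all_analysis.
Set Implicit Arguments.
Unset Strict Implicit.
Unset Printing Implicit Defensive.
Import Order.TTheory GRing.Theory Num.Theory.
Import numFieldNormedType.Exports.
Local Open Scope classical_set_scope.
Local Open Scope ring_scope.

(* For a symmetric real matrix there is exactly one such sequence; the default
   [::] is only reached when the characteristic polynomial does not split. *)
Definition ordered_eigenvalues (R : realType) (N : nat) (X : 'M[R]_N) : seq R :=
  xget [::] [set s | sorted <=%R s /\
                     char_poly X = \prod_(a <- s) ('X - a%:P)].

Lemma ordered_eigenvaluesE (R : realType) (N : nat) (X : 'M[R]_N) (s : seq R) :
  sorted <=%R s -> char_poly X = \prod_(a <- s) ('X - a%:P) ->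
  ordered_eigenvalues X = s.
Proof.
move=> s_le sX; apply: xget_unique; first by split.
move=> t [t_le tX]; apply: (le_sorted_eq t_le s_le).
by apply: prod_XsubC_eq; rewrite -tX -sX.
Qed.

Definition truncated_laplacian (R : realType) (N k : nat) (X : 'M[R]_N) : R :=
  \sum_(i < k) (ordered_eigenvalues X)`_i.

Section Notions.
Variables (R : realType) (n : nat).
(* The dimension is written n.+1 because the norm on row vectors, and the last
   coordinate, require it to be positive. *)
Implicit Types (u phi : 'rV[R]_n.+1 -> R) (x : 'rV[R]_n.+1) (X : 'M[R]_n.+1).

Definition last_coord x : R := x ord0 ord_max.

Definition one_dimensional u : Prop :=
  exists v : R -> R, forall x, u x = v (last_coord x).

Definition partial (i : 'I_n.+1) phi : 'rV[R]_n.+1 -> R :=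
  'D_(delta_mx ord0 i) phi.

Definition class_C1 phi : Prop :=
  continuous phi /\
  forall i, (forall x, derivable phi x (delta_mx ord0 i)) /\
            continuous (partial i phi).

Definition class_C2 phi : Prop :=
  class_C1 phi /\ forall i, class_C1 (partial i phi).

Definition hessian phi x : 'M[R]_n.+1 :=
  \matrix_(i, j) partial i (partial j phi) x.

Definition lsc u : Prop := lower_semicontinuous (fun x => (u x)%:E).
Definition usc u : Prop := lower_semicontinuous (fun x => (- u x)%:E).

Definition local_max_at (f : 'rV[R]_n.+1 -> R) x : Prop :=
  \forall y \near x, f y <= f x.
Definition local_min_at (f : 'rV[R]_n.+1 -> R) x : Prop :=
  \forall y \near x, f x <= f y.

Definition equation_lhs (k : nat) X (r : R) : R :=
  truncated_laplacian k X + r - r ^+ 3.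

Definition viscosity_subsolution (k : nat) u : Prop :=
  [/\ usc u, forall x, `|u x| < 1
    & forall phi x, class_C2 phi -> local_max_at (fun y => u y - phi y) x ->
        0 <= equation_lhs k (hessian phi x) (u x)].

Definition viscosity_supersolution (k : nat) u : Prop :=
  [/\ lsc u, forall x, `|u x| < 1
    & forall phi x, class_C2 phi -> local_min_at (fun y => u y - phi y) x ->
        equation_lhs k (hessian phi x) (u x) <= 0].

Definition viscosity_solution (k : nat) u : Prop :=
  viscosity_subsolution k u /\ viscosity_supersolution k u.

Definition classical_solution (k : nat) u : Prop :=
  [/\ class_C2 u, forall x, `|u x| < 1
    & forall x, equation_lhs k (hessian u x) (u x) = 0].

End Notions.

(* Main.v *)
(* For a function of [x_N] the truncated Laplacian of the Hessian is
   [min v'' 0].  Convex parabolas touching a subsolution from above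
   therefore have no diffusion term, which gives [v >= 0].  Testing a
   supersolution with affine functions shows that it is concave where it is
   positive, so it cannot be positive on the whole line; a classical solution
   would moreover have to leave a zero with zero slope while being concave, so
   it vanishes.  Viscosity solutions are allowed convex kinks at height zero:
   with [T t = tanh (t / sqrt 2)], which solves [T'' = T ^ 3 - T], both
   [max T 0] and [max T (- T)] are solutions.  As test functions
   depend on all the variables, checking this uses the variational
   characterization of the sum of the lowest eigenvalues of a symmetric
   matrix. *)
Require Import Defs.
From HB Require Import structures.
From mathcomp Require Import all_boot all_order all_algebra.
From mathcomp Require Import all_classical all_reals all_analysis.
From mathcomp Require Import perm complex spectral ring lra.
Set Implicit Arguments.
Unset Strict Implicit.
Unset Printing Implicit Defensive.
Import Order.TTheory GRing.Theory Num.Theory.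
Import numFieldNormedType.Exports.
Local Open Scope classical_set_scope.
Local Open Scope ring_scope.

(** * Sums of the lowest eigenvalues *)

Lemma Re_mulmx (R : rcfType) m n p (P : 'M[R[i]]_(m, n)) (Q : 'M[R[i]]_(n, p)) :
  map_mx (@complex.Re R) (P *m Q) =
  map_mx (@complex.Re R) P *m map_mx (@complex.Re R) Q - map_mx (@complex.Im R) P *m map_mx (@complex.Im R) Q.
Proof.
apply/matrixP => i j; rewrite !mxE -sumrB.
rewrite (big_morph (@complex.Re R) (id1 := 0) (op1 := +%R)) //; last by case=> ? ? [].
by apply: eq_bigr => k _; rewrite !mxE; case: (P i k); case: (Q k j).
Qed.

Lemma Im_mulmx (R : rcfType) m n p (P : 'M[R[i]]_(m, n)) (Q : 'M[R[i]]_(n, p)) :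
  map_mx (@complex.Im R) (P *m Q) =
  map_mx (@complex.Re R) P *m map_mx (@complex.Im R) Q + map_mx (@complex.Im R) P *m map_mx (@complex.Re R) Q.
Proof.
apply/matrixP => i j; rewrite !mxE -big_split /=.
rewrite (big_morph (@complex.Im R) (id1 := 0) (op1 := +%R)) //; last by case=> ? ? [].
by apply: eq_bigr => k _; rewrite !mxE; case: (P i k); case: (Q k j).
Qed.

Local Open Scope sesquilinear_scope.

(** Since [M] is real, the cross terms between the real and imaginary parts of [P] are purely
    imaginary. This turns identities about a unitary matrix into identities between real
    matrices. *)
Lemma Re_sandwich (R : rcfType) m n (P : 'M[R[i]]_(m, n)) (M : 'M[R]_n) :
  map_mx (@complex.Re R) (P *m map_mx (real_complex R) M *m P ^t*) =
  map_mx (@complex.Re R) P *m M *m (map_mx (@complex.Re R) P)^T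
  + map_mx (@complex.Im R) P *m M *m (map_mx (@complex.Im R) P)^T.
Proof.
have ReM : map_mx (@complex.Re R) (map_mx (real_complex R) M) = M.
  by apply/matrixP => i j; rewrite !mxE.
have ImM : map_mx (@complex.Im R) (map_mx (real_complex R) M) = 0.
  by apply/matrixP => i j; rewrite !mxE.
have RePt : map_mx (@complex.Re R) (P ^t*) = (map_mx (@complex.Re R) P)^T.
  by apply/matrixP => i j; rewrite !mxE; case: (P j i).
have ImPt : map_mx (@complex.Im R) (P ^t*) = - (map_mx (@complex.Im R) P)^T.
  by apply/matrixP => i j; rewrite !mxE; case: (P j i).
by rewrite !Re_mulmx Im_mulmx ReM ImM RePt ImPt !mulmx0 subr0 add0r mulmxN opprK.
Qed.

Lemma char_poly_conj (F : fieldType) n (P D : 'M[F]_n) :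
  P \in unitmx -> char_poly (invmx P *m D *m P) = char_poly D.
Proof.
move=> Pu; rewrite /char_poly.
have -> : char_poly_mx (invmx P *m D *m P) =
    map_mx polyC (invmx P) *m char_poly_mx D *m map_mx polyC P.
  rewrite /char_poly_mx mulmxBr mulmxBl -!map_mxM /=; congr (_ - _).
  by rewrite scalar_mxC -mulmxA -map_mxM mulVmx // map_mx1 mulmx1.
rewrite !det_mulmx mulrAC -det_mulmx -map_mxM mulVmx // map_mx1 det1.
exact: mul1r.
Qed.

(* [A] and [B] are the real and imaginary parts of a unitary matrix that
   diagonalizes [X]. *)
Lemma symmetric_spectral (R : rcfType) n (X : 'M[R]_n) : X^T = X ->
  exists (A B : 'M[R]_n) (d : 'rV[R]_n),
  [/\ A *m A^T + B *m B^T = 1%:M, A^T *m A + B^T *m B = 1%:M,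
      A *m X *m A^T + B *m X *m B^T = diag_mx d,
      X = A^T *m diag_mx d *m A + B^T *m diag_mx d *m B
    & char_poly X = \prod_i ('X - (d 0 i)%:P)].
Proof.
move=> Xsym; pose C := map_mx (real_complex R) X.
have Cherm : C \is hermsymmx.
  apply: realsym_hermsym.
    by apply/is_hermitianmxP; rewrite expr0 scale1r map_mx_id // map_trmx Xsym.
  by apply/mxOverP => i j; rewrite mxE; apply/complex_realP; eexists.
pose P := spectralmx C; have Pu : P \is unitarymx := spectral_unitarymx C.
have Punit := unitarymx_unit Pu.
have /hermitian_normalmx/orthomx_spectralP := Cherm; rewrite -/P => Ceq.
have dreal := hermitian_spectral_diag_real Cherm.
pose d := map_mx (@complex.Re R) (spectral_diag C).
have Dd : diag_mx (spectral_diag C) = map_mx (real_complex R) (diag_mx d).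
  rewrite map_diag_mx; congr diag_mx; apply/matrixP => i j; rewrite !mxE.
  have /mxOverP/(_ i j) := dreal; case: (spectral_diag C i j) => a b.
  by rewrite complex_real => /eqP ->.
have PtK : P ^t* ^t* = P by rewrite trmxCK.
have PV := invmx_unitary Pu.
have Re1 (M : 'M[R]_n) : map_mx (@complex.Re R) (map_mx (real_complex R) M) = M.
  by apply/matrixP => i j; rewrite !mxE.
have C1 : map_mx (real_complex R) (1%:M : 'M[R]_n) = 1%:M by rewrite map_mx1.
have RePt : map_mx (@complex.Re R) (P ^t*) = (map_mx (@complex.Re R) P)^T.
  by apply/matrixP => i j; rewrite !mxE; case: (P j i).
have ImPt : map_mx (@complex.Im R) (P ^t*) = - (map_mx (@complex.Im R) P)^T.
  by apply/matrixP => i j; rewrite !mxE; case: (P j i).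
exists (map_mx (@complex.Re R) P), (map_mx (@complex.Im R) P), d; split.
- have := Re_sandwich P 1%:M; rewrite !mulmx1 C1 mulmx1 => <-.
  by move/unitarymxP: Pu => ->; rewrite -C1 Re1.
- have := Re_sandwich (P ^t*) 1%:M; rewrite !mulmx1 C1 mulmx1 PtK RePt ImPt.
  rewrite -{1}PV mulVmx // -C1 Re1 => ->.
  by rewrite linearN /= !trmxK mulmxN mulNmx opprK.
- rewrite -Re_sandwich -/C {1}Ceq -PV -mulmxA.
  by rewrite !mulmxA mulmxK // mulmxV // mul1mx Dd Re1.
- rewrite -[LHS]Re1 -/C Ceq PV Dd -{2}PtK Re_sandwich RePt ImPt.
  by rewrite linearN /= !trmxK !mulNmx mulmxN opprK.
(* Checked over the complex numbers, where [C] is similar to a diagonal matrix. *)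
- apply: (map_poly_inj (real_complex R)); rewrite map_char_poly -/C.
  rewrite rmorph_prod /=.
  rewrite Ceq char_poly_conj // Dd char_poly_trig ?map_diag_mx ?diag_mx_is_trig//.
  by apply: eq_bigr => i _; rewrite map_polyXsubC !mxE eqxx.
Qed.

Local Close Scope sesquilinear_scope.

(* [W i j] is the squared modulus of the [j]-th coordinate of the [i]-th unit
   eigenvector. *)
Lemma truncated_laplacian_weights (R : realType) n k (X : 'M[R]_n) :
  X^T = X -> (k <= n)%N ->
  exists (d : 'I_n -> R) (W : 'I_n -> 'I_n -> R),
  [/\ truncated_laplacian k X = \sum_(i < n | (i < k)%N) d i,
      forall i j : 'I_n, (i <= j)%N -> d i <= d j,
      [/\ forall i j, 0 <= W i j, forall i, \sum_j W i j = 1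
        & forall j, \sum_i W i j = 1],
      forall j, X j j = \sum_i W i j * d i
    & forall c j, (forall x : 'rV_n, c * x 0 j ^+ 2 <= (x *m X *m x^T) 0 0) ->
      forall i, c * W i j <= d i].
Proof.
move=> Xsym kn; have [A [B [d [AAT ATA AXA XE Xchar]]]] := symmetric_spectral Xsym.
pose t := [tuple d 0 i | i < n]; pose s := sort <=%R t.
(* The eigenvalues of [d] come in no particular order; [p] relabels them, and with them the weights,
   in sorted order. *)
have /tuple_permP[p sp] : perm_eq s t by rewrite perm_sort.
have s_size : size s = n by rewrite size_sort size_tuple.
have s_nth (i : 'I_n) : s`_i = d 0 (p i).
  by rewrite sp -tnth_nth tnth_mktuple tnth_mktuple.
have s_sorted : sorted <=%R s by apply: sort_sorted; exact: le_total.
have Xs : char_poly X = \prod_(a <- s) ('X - a%:P).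
  rewrite Xchar (perm_big t) /=; last by rewrite perm_sort.
  by rewrite big_map -big_enum /= enumT.
pose W0 i j := A i j ^+ 2 + B i j ^+ 2.
exists (fun i => d 0 (p i)), (fun i j => W0 (p i) j); split.
- rewrite /truncated_laplacian (ordered_eigenvaluesE s_sorted Xs).
  rewrite (big_ord_widen _ (fun i => s`_i) kn).
  by apply: eq_bigr => i _; rewrite s_nth.
- move=> i j ij; rewrite -!s_nth.
  by apply: (sorted_leq_nth le_trans lexx) => //; rewrite inE s_size.
- split=> [i j|i|j]; first by rewrite addr_ge0 // sqr_ge0.
  + have /matrixP/(_ (p i) (p i)) := AAT; rewrite !mxE eqxx mulr1n -big_split /= => <-.
    by apply: eq_bigr => j _; rewrite !mxE.
  + have /matrixP/(_ j j) := ATA; rewrite !mxE eqxx mulr1n -big_split /= => <-.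
    rewrite [RHS](reindex_inj (@perm_inj _ p)).
    by apply: eq_bigr => i _; rewrite !mxE.
- move=> j; rewrite {1}XE !mxE -big_split /= [LHS](reindex_inj (@perm_inj _ p)).
  apply: eq_bigr => i _; rewrite !mul_mx_diag !mxE /W0.
  by rewrite mulrAC -expr2 [B _ _ * _ * _]mulrAC -expr2 -mulrDl.
- move=> c j cX i.
  (* An eigenvalue is the sum of the quadratic form at the real and imaginary parts of its unit
     eigenvector, and the lower bound applies to each part. *)
  have -> : d 0 (p i) = (row (p i) A *m X *m (row (p i) A)^T) 0 0 +
                        (row (p i) B *m X *m (row (p i) B)^T) 0 0.
    have rowE M : (row (p i) M *m X *m (row (p i) M)^T) 0 0 =
                  (M *m X *m M^T) (p i) (p i).
      by rewrite -row_mul !mxE; apply: eq_bigr => l _; rewrite !mxE.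
    have /matrixP/(_ (p i) (p i)) := AXA.
    by rewrite [RHS]mxE eqxx mulr1n => <-; rewrite !rowE [LHS]mxE.
  by rewrite mulrDr; have := lerD (cX (row (p i) A)) (cX (row (p i) B)); rewrite !mxE.
Qed.

(** Ky Fan's principle for coordinate subspaces: the diagonal entries in [J] spread a mass [k] over
    the spectrum, at most one on each eigenvalue, and the cheapest such distribution charges the [k]
    lowest. *)
Lemma truncated_laplacian_le (R : realType) n k (X : 'M[R]_n) (J : {set 'I_n}) :
  X^T = X -> #|J| = k -> truncated_laplacian k X <= \sum_(j in J) X j j.
Proof.
move=> Xsym Jk; have kn : (k <= n)%N by rewrite -Jk -[X in (_ <= X)%N]card_ord max_card.
have [d [W [-> d_le [W_ge0 Wrow Wcol] XE _]]] := truncated_laplacian_weights Xsym kn.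
case: k Jk kn => [|k] Jk kn.
  by rewrite (cards0_eq Jk) big_set0 big1.
pose w i := \sum_(j in J) W i j; pose mu := d (Ordinal kn).
have -> : \sum_(j in J) X j j = \sum_i w i * d i.
  under eq_bigr do rewrite XE.
  by rewrite exchange_big; apply: eq_bigr => i _; rewrite mulr_suml.
have w_ge0 i : 0 <= w i by apply: sumr_ge0.
have w_le1 i : w i <= 1.
  by rewrite -(Wrow i) /w [leRHS](bigID (mem J)) /= lerDl sumr_ge0.
have w_sum : \sum_i w i = k.+1%:R.
  rewrite exchange_big (eq_bigr (fun=> 1)) => [|j _]; last exact: Wcol.
  by rewrite sumr_const Jk.
have k_sum : \sum_(i < n) ((i < k.+1)%N%:R : R) = k.+1%:R.
  rewrite -natr_sum -big_mkcond /=.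
  by rewrite -(big_ord_widen _ (fun=> 1)%N kn) sum1_card card_ord.
rewrite big_mkcond -subr_ge0 -sumrB.
(* Compare each [d i] with the [k]-th eigenvalue [mu]: the weights [w] lie in
   [0, 1] and have total mass [k]. *)
have : \sum_i (w i - (i < k.+1)%N%:R) * mu <=
       \sum_i (w i * d i - (if (i < k.+1)%N then d i else 0)).
  apply: ler_sum => i _; case: ifPn => ik.
    have -> : w i * d i - d i = (w i - 1) * d i by rewrite mulrBl mul1r.
    by rewrite ler_wnM2l ?subr_le0 // d_le.
  rewrite !subr0 ler_wpM2l // d_le //=.
  by rewrite -ltnS ltnNge; move: ik; rewrite -leqNgt -ltnNge => /ltnW.
apply: le_trans; rewrite -mulr_suml sumrB w_sum k_sum subrr mul0r //.
Qed.

(** Each eigenvalue is at least [c] times its weight in direction [j]. These weights have total mass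
    one, so any [k] of them have mass at most one, and [c] is nonpositive. *)
Lemma truncated_laplacian_ge (R : realType) n k (X : 'M[R]_n) (c : R) (j : 'I_n) :
  X^T = X -> (k <= n)%N -> c <= 0 ->
  (forall x : 'rV_n, c * x 0 j ^+ 2 <= (x *m X *m x^T) 0 0) ->
  c <= truncated_laplacian k X.
Proof.
move=> Xsym kn c0 cX.
have [d [W [-> _ [W_ge0 _ Wcol] _ /(_ c j cX) cd]]] :=
  truncated_laplacian_weights Xsym kn.
apply: le_trans (ler_sum _ (fun i _ => cd i)); rewrite -mulr_sumr.
rewrite -[leLHS]mulr1 ler_wnM2l // -(Wcol j).
by rewrite [leRHS](bigID (fun i : 'I_n => (i < k)%N)) /= lerDl sumr_ge0.
Qed.

(** * Second derivatives *)

(** Both sides have the same difference quotient, so directional derivatives reduce to derivatives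
    in one variable. *)
Lemma is_derive_line (R : realType) (V W : normedModType R) (f : V -> W) x v s l :
  is_derive (x + s *: v) v f l <-> is_derive s 1 (fun t => f (x + t *: v)) l.
Proof.
have quot : (fun h : R => h^-1 *: ((f \o shift (x + s *: v)) (h *: v) - f (x + s *: v)))
  = (fun h : R => h^-1 *: (((fun t => f (x + t *: v)) \o shift s) (h *: 1)
       - f (x + s *: v))).
  apply/funext => h /=; congr (_ *: (f _ - _)).
  by rewrite [h *: 1]mulr1 scalerDl addrCA.
by split=> -[df dfE]; split; move: df dfE; rewrite /derivable /derive quot.
Qed.

Lemma is_derive_translate (R : realType) (V W : normedModType R) (f : V -> W)
    x v w l :
  is_derive (x + w) v f l -> is_derive x v (fun y => f (y + w)) l.
Proof.
have quot : (fun h : R => h^-1 *: (((fun y => f (y + w)) \o shift x) (h *: v) - f (x + w)))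
  = (fun h : R => h^-1 *: ((f \o shift (x + w)) (h *: v) - f (x + w))).
  by apply/funext => h /=; rewrite addrA.
by case=> df dfE; split; move: df dfE; rewrite /derivable /derive quot.
Qed.

(** The sign of [h] is free, hence the intermediate point is located only by its distance to [x]. *)
Lemma line_MVT (R : realType) (V : normedModType R) (f df : V -> R) x v (h : R) :
  (forall y, is_derive y v f (df y)) ->
  exists2 s : R, `|s| <= `|h| & f (x + h *: v) - f x = h * df (x + s *: v).
Proof.
move=> fd; pose g (s : R) := f (x + s *: v).
have gd (s : R) : is_derive s (1 : R) g (df (x + s *: v)) by exact: (is_derive_line f x v s _).1 (fd _).
have gc a b : {within `[a, b], continuous g}.
  apply: continuous_subspaceT => s.
  by apply/differentiable_continuous/derivable1_diffP; case: (gd s).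
have g0 : g 0 = f x by rewrite /g scale0r addr0.
have [h0|h0] := leP 0 h.
  have [s] := MVT_segment h0 (fun s _ => gd s) (gc _ _).
  rewrite in_itv /= => /andP[s0 sh]; rewrite g0 subr0 mulrC => gE.
  by exists s => //; rewrite !ger0_norm.
have [s] := MVT_segment (ltW h0) (fun s _ => gd s) (gc _ _).
rewrite in_itv /= => /andP[hs s0]; rewrite g0 sub0r => gE.
exists s; first by rewrite !ler0_norm ?lerN2 // ltW.
by rewrite -/(g h) -opprB gE mulrN opprK mulrC.
Qed.

Lemma cvg_dnbhs (T U : topologicalType) (f : T -> U) (x : T) (l : U) :
  f t @[t --> x] --> l -> f t @[t --> x^'] --> l.
Proof. by apply: cvg_trans; apply: cvg_app; exact: cvg_within. Qed.

Lemma cvg_addZ0 (R : realType) (V : normedModType R) T (F : set_system T)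
    {FF : Filter F} (z : T -> V) (r : T -> R) (w a : V) :
  z t @[t --> F] --> a -> r t @[t --> F] --> 0 ->
  z t + r t *: w @[t --> F] --> a.
Proof.
move=> za r0; have -> : a = a + 0 *: w by rewrite scale0r addr0.
by apply: cvgD => //; exact: cvgZr_tmp.
Qed.

(** * Directional derivatives and symmetry of the Hessian *)

Section Partial.
Variables (R : realType) (n : nat).
Implicit Types (f phi : 'rV[R]_n.+1 -> R) (x v : 'rV[R]_n.+1).

Lemma is_derive_partial f x i :
  class_C1 f -> is_derive x (delta_mx ord0 i) f (partial i f x).
Proof. by move=> [_ /(_ i)[/(_ x) fd _]]; split. Qed.

(** Induction step for [is_derive_C1]. The increment is split at [x + h *: v]; the remaining move
    along one axis is handled by the mean value theorem and the continuity of the partial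
    derivative. *)
Lemma is_derive_add_coord f x v c i l :
  class_C1 f -> is_derive x v f l ->
  is_derive x (v + c *: delta_mx ord0 i) f (l + c * partial i f x).
Proof.
move=> f1 [fv fvl]; pose e : 'rV[R]_n.+1 := delta_mx ord0 i.
have /choice[s sP] h : exists s, `|s| <= `|h * c| /\
    f (x + h *: v + (h * c) *: e) - f (x + h *: v) =
    h * c * partial i f (x + h *: v + s *: e).
  have [s] := line_MVT (x + h *: v) (h * c) (fun y => is_derive_partial y i f1).
  by exists s.
have s0 : s h @[h --> 0] --> 0.
  apply/norm_cvg0P; apply: (@squeeze_cvgr _ _ _ _ (fun=> 0) (fun h => `|h * c|)).
  - by near=> h; rewrite normr_ge0 (sP h).1.
  - exact: cvg_cst.
  - have : h * c @[h --> (0 : R)] --> 0 * c by apply: cvgMr_tmp; exact: cvg_id.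
    by rewrite mul0r => /cvg_norm; rewrite normr0.
have zx : x + h *: v + s h *: e @[h --> 0] --> x.
  apply: cvg_addZ0 s0; apply: cvg_addZ0; [exact: cvg_cst | exact: cvg_id].
have pz : partial i f (x + h *: v + s h *: e) @[h --> 0^'] --> partial i f x.
  exact: (cvg_comp _ _ (cvg_dnbhs zx) ((f1.2 i).2 x)).
suff cv : (fun h : R => h^-1 *: ((f \o shift x) (h *: (v + c *: e)) - f x))
    @ 0^' --> l + c * partial i f x.
  by split; [apply/cvg_ex; eexists; exact: cv | exact: cvg_lim cv].
move: fv => /cvg_ex[l' fl']; have <- : l' = l by rewrite -fvl; apply/esym/cvg_lim.
apply: cvg_trans (cvgD fl' (cvgMl_tmp (a := c) pz)); apply: near_eq_cvg.
near=> h; have hN0 : h != 0 by near: h; exact: nbhs_dnbhs_neq.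
have -> : (f \o shift x) (h *: (v + c *: e)) = f (x + h *: v + (h * c) *: e).
  by rewrite /= scalerDr scalerA addrC addrA.
transitivity (h^-1 * (f (x + h *: v) - f x) + c * partial i f (x + h *: v + s h *: e)).
  by rewrite {1}(addrC x (h *: v)).
rewrite -[f (x + h *: v + _)](subrK (f (x + h *: v))) (sP h).2.
by rewrite /GRing.scale /=; field.
Unshelve. all: by end_near. Qed.

Lemma is_derive_C1 f x v :
  class_C1 f -> is_derive x v f (\sum_i v 0 i * partial i f x).
Proof.
move=> f1; rewrite {1}(row_sum_delta v).
elim: (index_enum _) => [|i r IHr]; first by rewrite !big_nil; exact: is_derive0.
by rewrite !big_cons addrC [X in is_derive _ _ _ X]addrC; exact: is_derive_add_coord.
Qed.

(** Schwarz's theorem, which makes the eigenvalue bounds for symmetric matrices available for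
    Hessians of test functions. *)
Lemma hessian_sym phi x : class_C2 phi -> (hessian phi x)^T = hessian phi x.
Proof.
move=> [p1 p2]; apply/matrixP => i j; rewrite !mxE.
pose e i : 'rV[R]_n.+1 := delta_mx ord0 i.
pose D i j h := phi (x + h *: e i + h *: e j) - phi (x + h *: e i)
                - (phi (x + h *: e j) - phi x).
have DC i' j' h : D i' j' h = D j' i' h.
  by rewrite /D [x + _ + _]addrAC; ring.
(* The second difference [D i j h], symmetric in [i] and [j], is [h ^+ 2] times
   a mixed second derivative at a point close to [x]. *)
have DE i' j' h : exists st : R * R, [/\ `|st.1| <= `|h|, `|st.2| <= `|h| &
    D i' j' h = h * (h * partial i' (partial j' phi) (x + st.1 *: e j' + st.2 *: e i'))].
  pose g y := phi (y + h *: e i') - phi y.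
  pose dg y := partial j' phi (y + h *: e i') - partial j' phi y.
  have gd y : is_derive y (e j') g (dg y).
    apply: is_deriveB; last exact: is_derive_partial.
    exact/is_derive_translate/is_derive_partial.
  have [s sh gE] := line_MVT x h gd.
  have [t th dgE] := line_MVT (x + s *: e j') h
    (fun y => is_derive_partial y i' (p2 j')).
  exists (s, t); split=> //=; rewrite -dgE -gE /g /D.
  by rewrite [x + _ + _]addrAC; ring.
have lim i' j' : exists2 z : R -> 'rV[R]_n.+1, z h @[h --> 0] --> x &
    forall h, D i' j' h = h * (h * partial i' (partial j' phi) (z h)).
  have /choice[st stP] := DE i' j'.
  exists (fun h => x + (st h).1 *: e j' + (st h).2 *: e i'); last by move=> h; case: (stP h).
  have nc : `|h| @[h --> (0:R)] --> (0:R).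
    by have /cvg_norm := @cvg_id _ (nbhs (0 : R)); rewrite normr0.
  apply: cvg_addZ0.
    apply: cvg_addZ0; first exact: cvg_cst.
    apply/norm_cvg0P; apply: squeeze_cvgr (cvg_cst 0) nc.
    by near=> h; rewrite normr_ge0; case: (stP h).
  apply/norm_cvg0P; apply: squeeze_cvgr (cvg_cst 0) nc.
  by near=> h; rewrite normr_ge0; case: (stP h).
have lim' i' j' z : z h @[h --> (0:R)] --> x ->
    partial i' (partial j' phi) (z h) @[h --> 0^'] --> partial i' (partial j' phi) x.
  by move=> zx; exact: (cvg_comp _ _ (cvg_dnbhs zx) (((p2 j').2 i').2 x)).
have [z zx zE] := lim i j; have [z' zx' zE'] := lim j i.
apply: (cvg_unique _ _ (lim' i j z zx)) => //.
apply: cvg_trans (lim' j i z' zx'); apply: near_eq_cvg.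
near=> h; have hN0 : h != 0 by near: h; exact: nbhs_dnbhs_neq.
have := DC i j h; rewrite zE zE' => /(mulfI hN0)/(mulfI hN0) ->.
by [].
Unshelve. all: by end_near. Qed.

End Partial.

(** The slope [dw] vanishes at the maximum. If [l] were positive, [dw] would be positive just to the
    right of [0], and the mean value theorem would produce a value of [w] above the maximum. *)
Lemma second_derivative_max (R : realType) (w dw : R -> R) (l : R) :
  (forall s, is_derive s (1 : R) w (dw s)) -> is_derive (0 : R) (1 : R) dw l ->
  (\forall s \near 0, w s <= w 0) -> l <= 0.
Proof.
move=> wd dwd /nbhs_ballP[d /= d0 dmax].
have inball s e : s \in `]- e, e[ -> ball (0 : R) e s.
  by rewrite in_itv /= -ball_normE /= sub0r normrN ltr_norml.
have dw0 : dw 0 = 0.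
  have [_ dwE] := wd 0.
  suff [_ w0] : is_derive (0 : R) (1 : R) w 0 by rewrite -dwE.
  apply: (@derive1_at_max _ w (- d) d).
  - by rewrite ltW // gtrN.
  - by move=> t _; case: (wd t).
  - by rewrite in_itv /= oppr_lt0 d0.
  - by move=> t /inball; exact: dmax.
rewrite leNgt; apply/negP => l0.
have dwl : h^-1 * dw h @[h --> 0^'] --> l.
  have quot : (fun h : R => h^-1 *: ((dw \o shift 0) (h *: 1) - dw 0)) =
      (fun h => h^-1 * dw h).
    by apply/funext => h /=; rewrite dw0 subr0 addr0 [h *: 1]mulr1.
  by case: dwd => + <-; rewrite /derivable /derive quot => /cvg_ex[l' dl'];
     rewrite (cvg_lim _ dl').
have : \forall h \near (0 : R)^', 0 < h^-1 * dw h by exact: cvgr_gt dwl _ l0.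
rewrite near_withinE => /nbhs_ballP[e /= e0 eP].
pose h := Num.min d e / 2.
have h0 : 0 < h by rewrite divr_gt0 // lt_min d0 e0.
have [hd he] : h < d /\ h < e.
  have : h < Num.min d e by rewrite /h ltr_pdivrMr // ltr_pMr ?lt_min ?d0 // ltr1n.
  by rewrite lt_min => /andP.
have wc : {within `[0, h], continuous w}.
  apply: continuous_subspaceT => s.
  by apply/differentiable_continuous/derivable1_diffP; case: (wd s).
have [c] := MVT h0 (fun s _ => wd s) wc; rewrite in_itv /= => /andP[c0 ch] wE.
have : w h <= w 0 by apply: dmax; apply: inball; rewrite in_itv /= hd (lt_trans _ h0) ?oppr_lt0.
rewrite -subr_le0 wE subr0 leNgt pmulr_lgt0 //.
have : 0 < c^-1 * dw c.
  by apply: eP; [apply: inball; rewrite in_itv /= (lt_trans ch) // (lt_trans _ c0) ?oppr_lt0 | rewrite gt_eqF].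
by rewrite pmulr_rgt0 ?invr_gt0 // => ->.
Qed.

(** The argument of [A] moves with speed [c] while the point moves with velocity [v]. When [A] is
    evaluated at the last coordinate, [c] is the last coordinate of [v]. *)
Lemma line_second_derivative (R : realType) n (phi : 'rV[R]_n.+1 -> R) x v
    (A A1 : R -> R) (A2 t c : R) :
  class_C2 phi -> (forall s, is_derive s (1 : R) A (A1 s)) ->
  is_derive t (1 : R) A1 A2 ->
  exists2 dw : R -> R,
    forall s, is_derive s (1 : R) (fun s => A (t + s * c) - phi (x + s *: v)) (dw s)
  & is_derive (0 : R) (1 : R) dw
      (A2 * c ^+ 2 - (v *m hessian phi x *m v^T) 0 0).
Proof.
move=> [p1 p2] Ad A1d.
have cd s : is_derive s (1 : R) (fun s => t + s * c) c.
  exact: (is_derive_line id t c s c).1 (is_derive_id _ _).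
exists (fun s => A1 (t + s * c) * c - \sum_j v 0 j * partial j phi (x + s *: v)).
  move=> s; have d1 := @is_derive1_comp _ A (fun s => t + s * c) s _ _ (Ad _) (cd s).
  have d2 := (is_derive_line phi x v s _).1 (is_derive_C1 _ _ p1).
  exact: is_deriveB d1 d2.
have Hsum : (v *m hessian phi x *m v^T) 0 0 =
    \sum_j v 0 j * \sum_i v 0 i * partial i (partial j phi) x.
  rewrite mxE; apply: eq_bigr => j _; rewrite !mxE mulrC; congr (_ * _).
  by apply: eq_bigr => i _; rewrite mxE.
rewrite Hsum.
have d1 : is_derive (0 : R) (1 : R) (fun s => A1 (t + s * c) * c) (A2 * c ^+ 2).
  have A1d' : is_derive (t + 0 * c) (1 : R) A1 A2 by rewrite mul0r addr0.
  have d := @is_derive1_comp _ A1 (fun s => t + s * c) 0 _ _ A1d' (cd 0).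
  have -> : A2 * c ^+ 2 = c *: (A2 * c) by rewrite /GRing.scale /= expr2 mulrCA.
  have -> : (fun s => A1 (t + s * c) * c) = c \*: (A1 \o (fun s => t + s * c)).
    by apply/funext => s; rewrite /= mulrC.
  exact: is_deriveZ.
have d2 : is_derive (0 : R) (1 : R)
    (fun s => \sum_j v 0 j * partial j phi (x + s *: v))
    (\sum_j v 0 j * \sum_i v 0 i * partial i (partial j phi) x).
  have -> : (fun s : R => \sum_j v 0 j * partial j phi (x + s *: v)) =
      \sum_j (v 0 j \*: (fun s => partial j phi (x + s *: v))).
    by apply/funext => s; rewrite fct_sumE.
  apply: is_derive_sum => j; apply: is_deriveZ.
  have := (is_derive_line (partial j phi) x v 0 _).1; apply.
  by rewrite scale0r addr0; exact: is_derive_C1 (p2 j).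
exact: is_deriveB d1 d2.
Qed.

Lemma second_order_max (R : realType) n (phi : 'rV[R]_n.+1 -> R) x v
    (A A1 : R -> R) (A2 t c : R) :
  class_C2 phi -> (forall s, is_derive s (1 : R) A (A1 s)) ->
  is_derive t (1 : R) A1 A2 ->
  (\forall s \near 0, A (t + s * c) - phi (x + s *: v) <= A t - phi x) ->
  A2 * c ^+ 2 <= (v *m hessian phi x *m v^T) 0 0.
Proof.
move=> p2 Ad A1d wmax.
have [dw wd dwd] := line_second_derivative x v c p2 Ad A1d.
rewrite -subr_le0; apply: second_derivative_max wd dwd _.
by rewrite mul0r scale0r !addr0.
Qed.

Lemma second_order_min (R : realType) n (phi : 'rV[R]_n.+1 -> R) x v
    (A A1 : R -> R) (A2 t c : R) :
  class_C2 phi -> (forall s, is_derive s (1 : R) A (A1 s)) ->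
  is_derive t (1 : R) A1 A2 ->
  (\forall s \near 0, A t - phi x <= A (t + s * c) - phi (x + s *: v)) ->
  (v *m hessian phi x *m v^T) 0 0 <= A2 * c ^+ 2.
Proof.
move=> p2 Ad A1d wmin.
have [dw wd dwd] := line_second_derivative x v c p2 Ad A1d.
rewrite -subr_ge0 -oppr_le0.
apply: second_derivative_max (fun s => is_deriveN (wd s)) (is_deriveN dwd) _.
near=> s; rewrite /= lerN2 mul0r scale0r !addr0.
by near: s.
Unshelve. all: by end_near. Qed.

(** * Functions of the last coordinate *)

Lemma is_derive_mull (R : realType) (q : R -> R) (b t l : R) :
  is_derive t (1 : R) q l -> is_derive t (1 : R) (fun s => b * q s) (b * l).
Proof. by move=> qd; exact: (is_deriveZ b qd). Qed.

Section OneDimensional.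
Variables (R : realType) (n : nat).
Implicit Types (u phi : 'rV[R]_n.+1 -> R) (x : 'rV[R]_n.+1).

Local Notation e i := (delta_mx ord0 i : 'rV[R]_n.+1).
Local Notation last_axis t := (t *: e ord_max).

Lemma last_coordD x t i :
  last_coord (x + t *: e i) = last_coord x + t * (i == ord_max)%:R.
Proof. by rewrite /last_coord !mxE eqxx /= eq_sym. Qed.

Lemma last_coord_axis t : last_coord (last_axis t) = t.
Proof. by rewrite /last_coord !mxE !eqxx mulr1. Qed.

Lemma last_coord_continuous : continuous (@last_coord R n).
Proof. exact: coord_continuous. Qed.

Lemma last_axis_continuous : continuous (fun t : R => last_axis t).
Proof. exact: scalel_continuous. Qed.

Lemma is_derive_continuous (q q1 : R -> R) :
  (forall t, is_derive t (1 : R) q (q1 t)) -> continuous q.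
Proof.
move=> qd t; apply/differentiable_continuous/derivable1_diffP.
by case: (qd t).
Qed.

Lemma is_derive_last (q q1 : R -> R) x i :
  (forall t, is_derive t (1 : R) q (q1 t)) ->
  is_derive x (e i) (q \o @last_coord R n) ((i == ord_max)%:R * q1 (last_coord x)).
Proof.
move=> qd; set b : R := _%:R.
have := (is_derive_line (q \o @last_coord R n) x (e i) 0 (b * q1 (last_coord x))).2.
rewrite scale0r addr0; apply.
have -> : (fun t : R => (q \o @last_coord R n) (x + t *: e i)) =
    q \o (fun t => last_coord x + t * b).
  by apply/funext => t /=; rewrite last_coordD.
have ld := (is_derive_line id (last_coord x) b 0 b).1 (is_derive_id _ _).
rewrite mulrC; apply: is_derive1_comp ld.
by rewrite scale0r addr0.
Qed.

Lemma partial_last (q q1 : R -> R) i :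
  (forall t, is_derive t (1 : R) q (q1 t)) ->
  partial i (q \o @last_coord R n) =
  (fun t => (i == ord_max)%:R * q1 t) \o @last_coord R n.
Proof. by move=> qd; apply/funext => x; case: (is_derive_last x i qd). Qed.

Lemma class_C1_last (q q1 : R -> R) :
  (forall t, is_derive t (1 : R) q (q1 t)) -> continuous q1 ->
  class_C1 (q \o @last_coord R n).
Proof.
move=> qd q1c; have comp (g : R -> R) : continuous g ->
    continuous (g \o @last_coord R n).
  by move=> gc x; apply: continuous_comp; [exact: last_coord_continuous | exact: gc].
split=> [|i]; first exact/comp/(is_derive_continuous qd).
split=> [x|]; first by case: (is_derive_last x i qd).
rewrite (partial_last i qd); apply: comp => t.
by apply: cvgMl_tmp; exact: q1c.
Qed.

Lemma class_C2_last (q q1 q2 : R -> R) :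
  (forall t, is_derive t (1 : R) q (q1 t)) ->
  (forall t, is_derive t (1 : R) q1 (q2 t)) -> continuous q2 ->
  class_C2 (q \o @last_coord R n).
Proof.
move=> qd q1d q2c; split; first exact: class_C1_last (is_derive_continuous q1d).
move=> i; rewrite (partial_last i qd).
apply: (@class_C1_last _ (fun t => (i == ord_max)%:R * q2 t)) => t.
by apply: cvgMl_tmp; exact: q2c.
Qed.

Lemma hessian_last (q q1 q2 : R -> R) x :
  (forall t, is_derive t (1 : R) q (q1 t)) ->
  (forall t, is_derive t (1 : R) q1 (q2 t)) ->
  hessian (q \o @last_coord R n) x =
  q2 (last_coord x) *: delta_mx ord_max ord_max.
Proof.
move=> qd q1d; apply/matrixP => i j; rewrite !mxE (partial_last j qd).
rewrite (@partial_last _ (fun t => (j == ord_max)%:R * q2 t)) /=.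
by rewrite mulrA mulrC -natrM mulnb.
Qed.

Lemma one_dimensional_partial u j : one_dimensional u ->
  j != ord_max -> partial j u = fun=> 0.
Proof.
move=> [v uv] jN; apply/funext => x.
have := (is_derive_line u x (e j) 0 0).2.
have -> : (fun t : R => u (x + t *: e j)) = cst (u x).
  by apply/funext => t; rewrite !uv last_coordD (negPf jN) mulr0 addr0.
by rewrite scale0r addr0 => /(_ (is_derive_cst _ _ _))[].
Qed.

(** The difference quotient at [x] equals the one at the axis point with the same last
    coordinate. *)
Lemma one_dimensional_partial_last u : one_dimensional u ->
  one_dimensional (partial ord_max u).
Proof.
move=> [v uv]; exists (fun t => partial ord_max u (last_axis t)) => x.
rewrite /partial /derive; pose y := last_axis (last_coord x).
have -> // : (fun h : R => h^-1 *: ((u \o shift x) (h *: e ord_max) - u x)) =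
    (fun h : R => h^-1 *: ((u \o shift y) (h *: e ord_max) - u y)).
apply/funext => h /=; rewrite ![h *: _ + _]addrC !uv !last_coordD.
by rewrite last_coord_axis.
Qed.

(** Along every other axis both [u] and [partial ord_max u] are constant, so only the last diagonal
    entry can survive. *)
Lemma one_dimensional_hessian u x : one_dimensional u ->
  hessian u x = hessian u x ord_max ord_max *: delta_mx ord_max ord_max.
Proof.
move=> u1; apply/matrixP => i j; rewrite !mxE.
have [->|jN] /= := eqVneq j ord_max; last first.
  by rewrite andbF mulr0 (one_dimensional_partial u1 jN) /partial derive_cst.
rewrite andbT; have [->|iN] := eqVneq i ord_max; first by rewrite mulr1.
by rewrite mulr0 (one_dimensional_partial (one_dimensional_partial_last u1) iN).
Qed.

Lemma near_last (P : R -> Prop) x :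
  (\forall t \near last_coord x, P t) -> \forall y \near x, P (last_coord y).
Proof. exact: last_coord_continuous. Qed.

End OneDimensional.

(** * The truncated Laplacian and coordinate directions *)

Lemma quadratic_delta (R : realType) n (c : R) (v : 'rV[R]_n) j :
  (v *m (c *: delta_mx j j) *m v^T) 0 0 = c * v 0 j ^+ 2.
Proof.
rewrite -scalemxAr -scalemxAl mxE; congr (_ * _).
rewrite mxE (bigD1 j) //= big1 => [|i ij].
  rewrite addr0 !mxE (bigD1 j) //= big1 => [|i ij].
    by rewrite addr0 mxE !eqxx mulr1.
  by rewrite mxE (negPf ij) mulr0.
by rewrite !mxE big1 ?mul0r // => l _; rewrite mxE (negPf ij) andbF mulr0.
Qed.

Lemma quadratic_coord (R : realType) n (H : 'M[R]_n.+1) i :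
  ((delta_mx ord0 i : 'rV_n.+1) *m H *m (delta_mx ord0 i : 'rV_n.+1)^T) 0 0 = H i i.
Proof. by rewrite -rowE trmx_delta -colE !mxE. Qed.

Lemma card_ord_lt n k : (k <= n)%N -> #|[set i : 'I_n | (i < k)%N]%SET| = k.
Proof.
move=> kn; rewrite -sum1_card (eq_bigl (fun i : 'I_n => (i < k)%N)).
  by rewrite -(big_ord_widen _ (fun=> 1)%N kn) sum1_card card_ord.
by move=> i; rewrite inE.
Qed.

(** As [k] is at most the dimension minus one, the upper bound can be taken over [k] axes other than
    the last. *)
Lemma truncated_laplacian_tangential (R : realType) n k (X : 'M[R]_n.+2) :
  (k <= n.+1)%N -> X^T = X -> (forall i, i != ord_max -> X i i <= 0) ->
  truncated_laplacian k X <= 0.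
Proof.
move=> kn Xsym X0; have Jk := card_ord_lt (leqW kn).
apply: le_trans (truncated_laplacian_le Xsym Jk) _.
apply: sumr_le0 => i; rewrite inE => ik; apply: X0.
by rewrite -val_eqE /= ltn_eqF // (leq_trans ik).
Qed.

(** Here the upper bound is taken over the last axis and [k - 1] others. *)
Lemma truncated_laplacian_normal (R : realType) n k (X : 'M[R]_n.+2) :
  (1 <= k <= n.+1)%N -> X^T = X -> (forall i, i != ord_max -> X i i <= 0) ->
  truncated_laplacian k X <= X ord_max ord_max.
Proof.
case: k => // k /= kn Xsym X0.
have Nk : ord_max \notin [set i : 'I_n.+2 | (i < k)%N]%SET.
  by rewrite inE -leqNgt; exact: ltnW kn.
have Jk : #|(ord_max |: [set i : 'I_n.+2 | (i < k)%N])%SET| = k.+1.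
  by rewrite cardsU1 Nk card_ord_lt // leqW // ltnW.
apply: le_trans (truncated_laplacian_le Xsym Jk) _.
rewrite big_setU1 //= gerDl.
apply: sumr_le0 => i; rewrite inE => ik; apply: X0.
by rewrite -val_eqE /= ltn_eqF // (leq_trans ik) // ltnW.
Qed.

(** The tangential and normal bounds give one inequality. For the other, the form is at least
    [Num.min c 0] times the squared last coordinate. *)
Lemma truncated_laplacian_delta (R : realType) n k (c : R) :
  (1 <= k <= n.+1)%N ->
  truncated_laplacian k (c *: delta_mx ord_max ord_max : 'M[R]_n.+2) = Num.min c 0.
Proof.
move=> kn; set X := _ *: _; have [k0 kn1] := andP kn.
have Xsym : X^T = X by rewrite /X linearZ /= trmx_delta.
have X0 i : i != ord_max -> X i i <= 0.
  by move=> iN; rewrite !mxE (negPf iN) mulr0.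
apply/eqP; rewrite eq_le; apply/andP; split.
  rewrite le_min truncated_laplacian_tangential // andbT.
  by apply: le_trans (truncated_laplacian_normal kn Xsym X0) _; rewrite !mxE !eqxx mulr1.
apply: (truncated_laplacian_ge (j := ord_max) Xsym (leqW kn1)).
  by rewrite ge_min lexx orbT.
move=> x; rewrite quadratic_delta ler_wpM2r ?sqr_ge0 //.
by rewrite ge_min lexx.
Qed.

(** * Affine functions touching from below *)

Definition lsc1 (R : realType) (v : R -> R) :=
  forall t c, c < v t -> \forall s \near t, c < v s.

Lemma lsc1_add (R : realType) (v q : R -> R) :
  lsc1 v -> continuous q -> lsc1 (fun t => v t + q t).
Proof.
move=> v_lsc qc t l lv.
pose d := (v t + q t - l) / 2.
have d0 : 0 < d by rewrite divr_gt0 // subr_gt0.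
near=> s.
have vs : v t - d < v s by near: s; apply: v_lsc; rewrite gtrBl.
have : q t - d < q s by near: s; apply: (cvgr_gt _ (qc t)); rewrite gtrBl.
rewrite /d in vs *; lra.
Unshelve. all: by end_near. Qed.

(** Points with values below [c] are chosen for each [c] above the infimum. As [c] decreases to it
    they cluster in the compact segment, and lower semicontinuity makes the cluster point a
    minimizer. *)
Lemma lsc_attains_min (R : realType) (g : R -> R) (a b M : R) :
  a <= b -> (forall t, t \in `[a, b] -> M <= g t) -> lsc1 g ->
  exists2 p, p \in `[a, b] & forall s, s \in `[a, b] -> g p <= g s.
Proof.
move=> ab Mg glsc; pose m := inf (g @` `[a, b]).
have img_inf : has_inf (g @` `[a, b]).
  split; first by exists (g a), a => //=; rewrite in_itv /= lexx.
  by exists M => _ [t tab <-]; exact: Mg.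
(* The premise stands under the existential so that [choice] yields a function defined for all
   [c]. *)
have below c : exists t, m < c -> t \in `[a, b] /\ g t < c.
  have [mc|] := boolP (m < c); last by exists a.
  by have [_ [t tab <-] gt] := inf_lt img_inf.1 mc; exists t.
have [t tP] := choice below.
have t_itv : \forall c \near m^'+, t c \in `[a, b].
  near=> c; have mc : m < c by near: c; exact: nbhs_right_gt.
  by case: (tP _ mc).
have t_lt c0 : m < c0 -> \forall c \near m^'+, g (t c) < c0.
  move=> mc0; near=> c; have mc : m < c by near: c; exact: nbhs_right_gt.
  by apply: lt_trans (tP _ mc).2 _; near: c; exact: nbhs_right_lt.
have [p [pab pt]] : `[a, b]%classic `&` cluster (t c @[c --> m^'+]) !=set0.
  exact: segment_compact t_itv.
exists p => // s sab; rewrite leNgt; apply/negP => gsp.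
have ms : m <= g s by apply: ge_inf; [exact: img_inf.2 | exists s].
pose c0 := (m + g p) / 2.
have [mc0 c0p] : m < c0 /\ c0 < g p.
  by split; [rewrite midf_lt | rewrite midf_lt]; rewrite ?(le_lt_trans ms).
have [q [/= qc0 /ltW]] := pt [set s | g s < c0] _ (t_lt _ mc0) (glsc _ _ c0p).
by rewrite leNgt qc0.
Unshelve. all: by end_near. Qed.

(* For a one-dimensional supersolution this is the equation tested with affine
   functions of [x_N]: their Hessian vanishes, so [v t - v t ^+ 3 <= 0]. *)
Definition affine_touch (R : realType) (v : R -> R) :=
  forall t b, (\forall s \near t, v t - b * t <= v s - b * s) -> v t <= 0.

Section AffineTouch.
Variables (R : realType) (v : R -> R).
Hypotheses (v_lsc : lsc1 v) (v_bound : forall t, `|v t| < 1).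


Lemma touch_interior c a b p : affine_touch v -> p \in `]a, b[ ->
  (forall s, s \in `[a, b] -> v p - c * p <= v s - c * s) -> v p <= 0.
Proof.
move=> vt pab pmin; apply: (vt p c).
near=> s; apply: pmin; apply: subset_itv_oo_cc; near: s.
exact: near_in_itvoo.
Unshelve. all: by end_near. Qed.

Lemma affine_attains_min c a b : a <= b ->
  exists2 p, p \in `[a, b] &
    forall s, s \in `[a, b] -> v p - c * p <= v s - c * s.
Proof.
(* The [- 1] bounds [v] from below and the product bounds the linear term on the segment. *)
move=> ab; apply: (@lsc_attains_min _ _ _ _ (- 1 - `|c| * (`|a| + `|b|))) => //.
  move=> t; rewrite in_itv /= => /andP[ta tb].
  have : `|c * t| <= `|c| * (`|a| + `|b|).
    rewrite normrM ler_wpM2l //.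
    have [t0|t0] := leP 0 t.
      rewrite (ger0_norm t0) (ger0_norm (le_trans t0 tb)).
      by rewrite (le_trans tb) // lerDr.
    rewrite (ltr0_norm t0) (ler0_norm (le_trans ta (ltW t0))).
    by rewrite (@le_trans _ _ (- a)) ?lerN2 // lerDl.
  have := ler_norm (c * t); have := v_bound t; rewrite ltr_norml => /andP[].
  lra.
apply: lsc1_add => // t; apply: cvgN; apply: cvgMl_tmp; exact: cvg_id.
Qed.

(** Concavity where [v] is positive: an interior minimum of [v] minus the affine function would be a
    contact point, where [v] is nonpositive. The minimum is therefore at an endpoint. *)
Lemma affine_below a b l c : affine_touch v -> a < b ->
  (forall s, s \in `]a, b[ -> 0 < v s) ->
  l + c * a <= v a -> l + c * b <= v b ->
  forall s, s \in `[a, b] -> l + c * s <= v s.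
Proof.
move=> vt ab v0 la lb s sab.
have [p pab pmin] := affine_attains_min c (ltW ab).
suff : l + c * p <= v p by have := pmin _ sab; lra.
have [->//|pNa] := eqVneq p a; have [->//|pNb] := eqVneq p b.
have pI : p \in `]a, b[ by rewrite in_itv /= !lt_neqAle eq_sym pNa pNb !(itvP pab).
by have := v0 _ pI; rewrite ltNge => /negP[]; exact: touch_interior vt pI pmin.
Qed.

(* A positive [v] lies above its chords; sending the zero of a chord to minus or
   plus infinity shows that [v] is constant, hence touched by a constant. *)
Lemma affine_touch_not_positive : affine_touch v -> ~ (forall t, 0 < v t).
Proof.
move=> vt v0.
have below a b l c : a < b -> l + c * a <= v a -> l + c * b <= v b ->
    forall s, s \in `[a, b] -> l + c * s <= v s.
  by move=> ab; apply: affine_below => // s _.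
have vdecr s t : s < t -> v t <= v s.
  move=> st; rewrite leNgt; apply/negP => vst.
  (* The chord from [(a, 0)] to [(t, v t)] exceeds [v s] at [s] when
     [a * (v t - v s) < v t * s - v s * t]. The [- 1] makes this strict, and [s - 1] keeps [a] to
     the left of [s]. *)
  pose a := Num.min (s - 1) ((v t * s - v s * t - 1) / (v t - v s)).
  have as_ : a < s by rewrite /a gt_min ltrBlDr ltrDl ltr01.
  have aE : a * (v t - v s) <= v t * s - v s * t - 1.
    by rewrite -ler_pdivlMr ?subr_gt0 // /a ge_min lexx orbT.
  have at_ : a < t by exact: lt_trans st.
  pose c := v t / (t - a).
  have cE : c * (t - a) = v t by rewrite /c divfK // subr_eq0 gt_eqF.
  have : - (c * a) + c * s <= v s.
    apply: (below a t) => //; last by rewrite in_itv /= (ltW as_) (ltW st).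
    + by rewrite addNr ltW.
    + by rewrite addrC -mulrBr cE.
  rewrite addrC -mulrBr => /(ler_wpM2r (ltW _))-/(_ (t - a)).
  rewrite subr_gt0 mulrAC cE => /(_ at_); lra.
have vincr s t : s < t -> v s <= v t.
  move=> st; rewrite leNgt; apply/negP => vst.
  (* Mirror image, with the chord from [(s, v s)] to [(b, 0)]. *)
  pose b := Num.max (t + 1) ((v s * t - v t * s + 1) / (v s - v t)).
  have tb : t < b by rewrite /b lt_max ltrDl ltr01.
  have bE : v s * t - v t * s + 1 <= b * (v s - v t).
    by rewrite -ler_pdivrMr ?subr_gt0 // /b le_max lexx orbT.
  have sb : s < b by exact: lt_trans tb.
  pose c := v s / (s - b).
  have cE : c * (s - b) = v s by rewrite /c divfK // subr_eq0 lt_eqF.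
  have : - (c * b) + c * t <= v t.
    apply: (below s b) => //; last by rewrite in_itv /= (ltW st) (ltW tb).
    + by rewrite addrC -mulrBr cE.
    + by rewrite addNr ltW.
  rewrite addrC -mulrBr => /(ler_wnM2r (ltW _))-/(_ (s - b)).
  rewrite subr_lt0 mulrAC cE => /(_ sb); lra.
have vc t : v t = v 0.
  case: (ltgtP t 0) => [t0|t0|-> //]; apply/eqP; rewrite eq_le.
    by rewrite (vincr _ _ t0) (vdecr _ _ t0).
  by rewrite (vincr _ _ t0) (vdecr _ _ t0).
have := v0 0; rewrite ltNge => /negP; apply; apply: (vt 0 0).
by near=> s; rewrite !mul0r vc.
Unshelve. all: by end_near. Qed.

(** The points [0] and [1] are a normalization: a line can be parametrized so that they hit any two
    given points. The slope condition is what a differentiable nonnegative function satisfies at its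
    zeros. *)
Lemma affine_touch_zero : affine_touch v -> (forall t, 0 <= v t) ->
  (forall t, v t = 0 -> is_derive t (1 : R) v 0) -> v 0 = 0 -> v 1 = 0.
Proof.
move=> vt v0 vd v00; apply/eqP; rewrite eq_le v0 andbT leNgt; apply/negP => v1.
pose c := v 1 / 2; have c0 : 0 < c by rewrite divr_gt0.
(* Where [v - c t] is minimal on [0, 1] the function [v] vanishes, so it grows at
   rate at least [c] from a point at which its derivative is [0]. *)
have [p pab pmin] := affine_attains_min c ler01.
(* Since [c < v 1], the function [v - c t] is larger at [1] than at [0]. *)
have p1 : p != 1.
  apply: contraTneq isT => p1; have := pmin 0; rewrite p1 in_itv /= lexx ler01 v00.
  move=> /(_ isT); rewrite /c; lra.
have p_lt1 : p < 1 by rewrite lt_neqAle p1 (itvP pab).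
have vp : v p = 0.
  have [->//|pN0] := eqVneq p 0.
  apply/eqP; rewrite eq_le v0 andbT; apply: (@touch_interior c 0 1) => //.
  by rewrite in_itv /= p_lt1 lt_neqAle eq_sym pN0 (itvP pab).
have quot : h^-1 * v (h + p) @[h --> 0^'] --> (0 : R).
  have quotE : (fun h : R => h^-1 *: ((v \o shift p) (h *: 1) - v p)) =
      (fun h => h^-1 * v (h + p)).
    by apply/funext => h /=; rewrite vp subr0 [h *: 1]mulr1.
  case: (vd _ vp); rewrite /derivable /derive quotE => /cvg_ex[l dl].
  by rewrite (cvg_lim _ dl) // => l0; rewrite -[X in _ --> X]l0.
have : \forall h \near (0 : R)^', h^-1 * v (h + p) < c by exact: cvgr_lt quot _ c0.
rewrite near_withinE => /nbhs_ballP[d /= d0 dP].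
pose h := Num.min d (1 - p) / 2.
have m0 : 0 < Num.min d (1 - p) by rewrite lt_min d0 subr_gt0.
have h0 : 0 < h by rewrite divr_gt0.
have : h < Num.min d (1 - p) by rewrite /h ltr_pdivrMr // ltr_pMr // ltr1n.
rewrite lt_min => /andP[hd hp].
have : h^-1 * v (h + p) < c.
  by apply: dP; [rewrite -ball_normE /= sub0r normrN gtr0_norm | rewrite gt_eqF].
rewrite mulrC ltr_pdivrMr // ltNge => /negP; apply.
have := pmin (h + p); rewrite in_itv /= vp addr_ge0 ?(ltW h0) ?(itvP pab) //=.
rewrite -lerBrDr (ltW hp) => /(_ isT); lra.
Qed.

End AffineTouch.

(** * One-dimensional sub- and supersolutions *)

Lemma cubic_le0 (R : realType) (r : R) : `|r| < 1 -> r - r ^+ 3 <= 0 -> r <= 0.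
Proof.
rewrite ltr_norml => /andP[r1 r2] r3; rewrite leNgt; apply/negP => r0.
suff : 0 < r * ((1 - r) * (1 + r)) by move: r3; lra.
by rewrite !mulr_gt0 //; lra.
Qed.

Lemma cubic_ge0 (R : realType) (r : R) : `|r| < 1 -> 0 <= r - r ^+ 3 -> 0 <= r.
Proof.
move=> r1 r3; rewrite -oppr_le0; apply: cubic_le0; first by rewrite normrN.
lra.
Qed.

Lemma near_line (R : realType) (V : normedModType R) (P : V -> Prop) x v :
  (\forall y \near x, P y) -> \forall s \near (0 : R), P (x + s *: v).
Proof.
have line : x + s *: v @[s --> (0 : R)] --> x.
  by apply: cvg_addZ0; [exact: cvg_cst | exact: cvg_id].
exact: line.
Qed.

Section Touch.
Variables (R : realType) (n k : nat).
Hypothesis hk : (1 <= k <= n.+1)%N.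
Implicit Types (u phi : 'rV[R]_n.+2 -> R) (v : R -> R) (x : 'rV[R]_n.+2).

Local Notation e i := (delta_mx ord0 i : 'rV[R]_n.+2).

Lemma last_coord_line x w (s : R) :
  last_coord (x + s *: w) = last_coord x + s * last_coord w.
Proof. by rewrite /last_coord !mxE. Qed.

Lemma lsc1_last u v : (forall x, u x = v (last_coord x)) -> lsc u -> lsc1 v.
Proof.
move=> uv ulsc t c cv.
have [|V Vn VP] := ulsc (t *: e ord_max) c; first by rewrite lte_fin uv last_coord_axis.
have Vt : \forall s \near t, V (s *: e ord_max).
  exact: (@last_axis_continuous R n.+1 t _ Vn).
by apply: filterS Vt => s /VP; rewrite lte_fin uv last_coord_axis.
Qed.

(** One family for both tests: [c = 0] gives the affine functions used on supersolutions, [b = 0]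
    with [c] positive the convex parabolas used on subsolutions. *)
Lemma quadratic_test (c b t0 : R) :
  let q := (fun s => c * (s - t0) ^+ 2 + b * s) in
  class_C2 (q \o @last_coord R n.+1) /\
  (forall x, hessian (q \o @last_coord R n.+1) x =
             (2 * c) *: delta_mx ord_max ord_max).
Proof.
move=> q; pose q1 s := 2 * c * (s - t0) + b.
have idd (s : R) : is_derive s (1 : R) (fun s => s - t0) 1.
  by have := is_deriveB (is_derive_id s (1 : R)) (is_derive_cst t0 s 1); rewrite subr0.
have qd s : is_derive s (1 : R) q (q1 s).
  have d1 := is_derive_mull c (is_deriveX 2 (idd s)).
  have d2 := is_derive_mull b (is_derive_id s (1 : R)).
  apply: is_derive_eq (is_deriveD d1 d2) _.
  by rewrite /q1 /GRing.scale /=; ring.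
have q1d s : is_derive s (1 : R) q1 (2 * c).
  have := is_deriveD (is_derive_mull (2 * c) (idd s)) (is_derive_cst b s 1).
  by rewrite mulr1 addr0.
split; first by apply: class_C2_last qd q1d _ => s; exact: cvg_cst.
by move=> x; exact: hessian_last qd q1d.
Qed.

Lemma supersolution_affine_touch u v : (forall x, u x = v (last_coord x)) ->
  viscosity_supersolution k u -> affine_touch v.
Proof.
move=> uv [_ u1 usup] t b vmin.
have [C2q Hq] := quadratic_test 0 b 0.
have := usup _ (t *: e ord_max) C2q.
rewrite Hq /equation_lhs mulr0 truncated_laplacian_delta // minxx add0r.
rewrite uv last_coord_axis => vsup; apply: cubic_le0 (vsup _).
  by have := u1 (t *: e ord_max); rewrite uv last_coord_axis.
have := @near_last R n.+1 _ (t *: e ord_max); rewrite last_coord_axis => /(_ _ vmin) H.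
apply: filterS H => y; rewrite /= !uv last_coord_axis !mul0r !add0r.
exact.
Qed.

(** If [v t0] were negative, a steep convex parabola centered at [t0] would touch [v] from above at
    a nearby [p]. Its truncated Laplacian is zero, so the equation forces [0 <= v p], while upper
    semicontinuity keeps [v p] negative. *)
Lemma subsolution_ge0 u v : (forall x, u x = v (last_coord x)) ->
  viscosity_subsolution k u -> forall t, 0 <= v t.
Proof.
move=> uv [uusc u1 usub] t0; rewrite leNgt; apply/negP => vt0.
have v1 t : `|v t| < 1 by have := u1 (t *: e ord_max); rewrite uv last_coord_axis.
have vlsc : lsc1 (fun t => - v t).
  by apply: (@lsc1_last (fun x => - u x)) => // x; rewrite uv.
have /nbhs_ballP[d /= d0 dP] : \forall s \near t0, - (v t0 / 2) < - v s.
  by apply: vlsc; lra.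
pose r := d / 2; have r0 : 0 < r by rewrite divr_gt0.
(* The parabola rises by [c * r ^+ 2 = 1] from [t0] to the ends of the interval, where [v] exceeds
   [v t0] by less than [- v t0 / 2 < 1]; this keeps the minimum of [g] away from the ends. *)
pose c := r ^- 2; have c0 : 0 < c by rewrite invr_gt0 exprn_gt0.
have cr : c * r ^+ 2 = 1 by rewrite mulVf // expf_neq0 // gt_eqF.
pose g t := - v t + c * (t - t0) ^+ 2.
have ab : t0 - r <= t0 + r by lra.
have gM t : t \in `[t0 - r, t0 + r] -> -1 <= g t.
  move=> _; have := v1 t; rewrite ltr_norml => /andP[_ vt].
  have : 0 <= c * (t - t0) ^+ 2 by rewrite mulr_ge0 ?sqr_ge0 ?ltW.
  rewrite /g; lra.
have glsc : lsc1 g.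
  apply: lsc1_add => // t; apply: cvgMl_tmp.
  apply: (@continuous_comp _ _ _ (fun t => t - t0) (fun t => t ^+ 2)).
    by apply: cvgB; [exact: cvg_id | exact: cvg_cst].
  exact: exprn_continuous.
have [p pI pmin] := lsc_attains_min ab gM glsc.
have vball t : `|t - t0| <= r -> v t < v t0 / 2.
  move=> tr; have : - (v t0 / 2) < - v t; last by rewrite ltrN2.
  by apply: dP; rewrite -ball_normE /= distrC (le_lt_trans tr) // /r ltr_pdivrMr // ltr_pMr // ltr1n.
have pr : `|p - t0| <= r by rewrite ler_distl; move: pI; rewrite in_itv.
have vp := vball _ pr.
have gp : g p <= - v t0.
  have := pmin t0; rewrite in_itv /= gerBl ltW // lerDl ltW // => /(_ isT).
  by rewrite {2}/g subrr expr0n mulr0 addr0.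
have p_in : p \in `](t0 - r), (t0 + r)[.
  rewrite in_itv /= -ltr_distl lt_neqAle pr andbT; apply/eqP => pr'.
  have : c * (p - t0) ^+ 2 = 1 by rewrite -[(p - t0) ^+ 2]ger0_norm ?sqr_ge0 // normrX pr'.
  have := v1 t0; rewrite ltr_norml => /andP[].
  move: gp; rewrite /g; lra.
have [C2q Hq] := quadratic_test c 0 t0.
have := usub _ (p *: e ord_max) C2q.
rewrite Hq /equation_lhs truncated_laplacian_delta // min_r ?mulr_ge0 ?(ltW c0) //.
rewrite add0r uv last_coord_axis => vsub.
suff : 0 <= v p by move: vt0 vp; lra.
apply: cubic_ge0 (v1 p) (vsub _).
have := @near_last R n.+1 _ (p *: e ord_max); rewrite last_coord_axis.
move=> /(_ _ (near_in_itvoo p_in)) H; apply: filterS H => y yI /=.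
rewrite !uv last_coord_axis !mul0r !addr0.
by have := pmin _ (subset_itv_oo_cc yI); rewrite /g; lra.
Qed.

End Touch.

Lemma continuous_lsc1 (R : realType) (v : R -> R) : continuous v -> lsc1 v.
Proof. by move=> vc t c; exact: (cvgr_gt _ (vc t)). Qed.

Lemma continuous_lsc (R : realType) n (u : 'rV[R]_n.+1 -> R) :
  continuous u -> lsc u.
Proof.
move=> uc x a; rewrite lte_fin => ax; exists [set y | a < u y] => [|y].
  exact: (cvgr_gt _ (uc x)).
by rewrite lte_fin.
Qed.

Lemma continuous_usc (R : realType) n (u : 'rV[R]_n.+1 -> R) :
  continuous u -> usc u.
Proof.
move=> uc; apply: (@continuous_lsc _ _ (fun x => - u x)) => x.
exact: (cvgN (uc x)).
Qed.

(** * Classical solutions *)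

Section Classical.
Variables (R : realType) (n k : nat) (u : 'rV[R]_n.+2 -> R).
Hypotheses (hk : (1 <= k <= n.+1)%N) (u_one : one_dimensional u).
Hypothesis u_sol : classical_solution k u.

Let u_C2 : class_C2 u. Proof. by case: u_sol. Qed.
Let u_bound x : `|u x| < 1. Proof. by case: u_sol. Qed.

Lemma classical_equation x :
  Num.min (hessian u x ord_max ord_max) 0 + u x - u x ^+ 3 = 0.
Proof.
have [_ _ E] := u_sol; transitivity (equation_lhs k (hessian u x) (u x)) => //.
by rewrite /equation_lhs -(truncated_laplacian_delta _ hk) -one_dimensional_hessian.
Qed.

Lemma classical_ge0 x : 0 <= u x.
Proof.
apply: cubic_ge0 (u_bound x) _; have := classical_equation x.
have : Num.min (hessian u x ord_max ord_max) 0 <= 0 by rewrite ge_min lexx orbT.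
lra.
Qed.

Lemma classical_line_derive x w s : exists l : R,
  is_derive s (1 : R) (fun s => u (x + s *: w)) l.
Proof.
eexists; apply: (is_derive_line u x w s _).1.
by apply: is_derive_C1; case: u_C2.
Qed.

(** Contact from below makes the second derivative along [w] nonnegative, hence also the one in the
    last coordinate, because [w] is transversal. The diffusion term of the pointwise equation then
    vanishes. *)
Lemma classical_affine_touch x w : last_coord w != 0 ->
  affine_touch (fun s : R => u (x + s *: w)).
Proof.
move=> wN s b smin; pose y := x + s *: w.
have bd t : is_derive t (1 : R) (fun s : R => b * s) b.
  by have := is_derive_mull b (is_derive_id t (1 : R)); rewrite mulr1.
have H0 : 0 * 1 ^+ 2 <= (w *m hessian u y *m w^T) 0 0.
  apply: (@second_order_max _ _ u y w (fun s => b * s) (fun=> b) 0 s 1) => //.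
  have := @near_line _ R^o _ s 1 smin; apply: filterS => h /=.
  have -> : y + h *: w = x + (s + h *: 1) *: w by rewrite /y scalerDl addrA [h *: 1]mulr1.
  rewrite [h *: 1]mulr1 mulr1 /y; lra.
rewrite mul0r (one_dimensional_hessian _ u_one) quadratic_delta in H0.
have {}H0 : 0 <= hessian u y ord_max ord_max.
  by rewrite -(@pmulr_lge0 _ (w 0 ord_max ^+ 2)) // exprn_even_gt0.
apply: cubic_le0 (u_bound y) _; have := classical_equation y.
by rewrite min_r // add0r => ->.
Qed.

(** Along the last axis [u] cannot stay positive, so it has a zero. Zeros are minima of [u], hence
    have zero slope, and [affine_touch_zero] carries the vanishing to every other point. *)
Lemma classical_eq0 x : u x = 0.
Proof.
have [v uv] := u_one.
pose e : 'rV[R]_n.+2 := delta_mx ord0 ord_max.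
have line y w : [/\ lsc1 (fun s : R => u (y + s *: w)),
    forall s, `|u (y + s *: w)| < 1 & forall s, 0 <= u (y + s *: w)].
  split=> [|s|s]; [|exact: u_bound|exact: classical_ge0].
  apply: continuous_lsc1 => s; have [l []] := classical_line_derive y w s.
  by move=> dl _; apply/differentiable_continuous/derivable1_diffP.
have [t ut] : exists t, u (0 + t *: e) = 0.
  have [lc bd ge0] := line 0 e.
  have touch : affine_touch (fun s : R => u (0 + s *: e)).
    by apply: classical_affine_touch; rewrite /last_coord mxE !eqxx oner_neq0.
  have /existsNP[t /negP] := affine_touch_not_positive lc bd touch.
  by rewrite -leNgt => ut; exists t; apply/eqP; rewrite eq_le ut ge0.
have [xt|xt] := eqVneq (last_coord x) t.
  by rewrite uv xt -ut uv add0r last_coord_axis.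
(* Parametrized so that [0] gives the known zero and [1] a point with the last coordinate of [x]. *)
pose w := (last_coord x - t) *: e.
have [lc bd ge0] := line (0 + t *: e) w.
have -> : u x = u (0 + t *: e + 1 *: w).
  by rewrite !uv scale1r add0r /w -scalerDl last_coord_axis addrC subrK.
apply: (affine_touch_zero lc bd) => //; last by rewrite scale0r addr0.
  by apply: classical_affine_touch; rewrite last_coord_axis subr_eq0.
move=> s us; have sd r := classical_line_derive (0 + t *: e) w r.
apply: (@derive1_at_min _ _ (s - 1) (s + 1)).
- by lra.
- by move=> r _; have [l []] := sd r.
- by rewrite in_itv /=; apply/andP; split; lra.
- by move=> r _; rewrite us.
Qed.

End Classical.

Lemma zero_classical_solution (R : realType) n k (u : 'rV[R]_n.+2 -> R) :
  (1 <= k <= n.+1)%N -> (forall x, u x = 0) ->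
  one_dimensional u /\ classical_solution k u.
Proof.
move=> hk u0; have -> : u = (fun=> 0) by apply/funext.
split; first by exists (fun=> 0).
have [C2q Hq] := @quadratic_test R n 0 0 0.
have E : (fun s : R => 0 * (s - 0) ^+ 2 + 0 * s) \o @last_coord R n.+1 = (fun=> 0).
  by apply/funext => x /=; rewrite !mul0r addr0.
rewrite E in C2q Hq; split=> // x; first by rewrite normr0 ltr01.
by rewrite Hq /equation_lhs truncated_laplacian_delta // mulr0 minxx expr0n subr0 addr0.
Qed.

(** * Maxima of two solutions *)

Section MaxSolution.
Variables (R : realType) (n k : nat).
Hypothesis hk : (1 <= k <= n.+1)%N.
Local Notation e i := (delta_mx ord0 i : 'rV[R]_n.+2).
Implicit Types (phi : 'rV[R]_n.+2 -> R) (x : 'rV[R]_n.+2) (F v : R -> R).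

(** As [F] lies below [v] with equality at [x], contact of [phi] from above passes to [F]. Along
    every line the Hessian then dominates [F ^+ 3 - F] times the squared last coordinate, a
    nonpositive factor because [0 <= F < 1] there. *)
Lemma subsolution_touch F F1 v phi x :
  (forall t, is_derive t (1 : R) F (F1 t)) ->
  (forall t, is_derive t (1 : R) F1 (F t ^+ 3 - F t)) ->
  `|F (last_coord x)| < 1 -> 0 <= F (last_coord x) ->
  (forall t, F t <= v t) -> v (last_coord x) = F (last_coord x) ->
  class_C2 phi -> local_max_at (fun y => v (last_coord y) - phi y) x ->
  0 <= equation_lhs k (hessian phi x) (v (last_coord x)).
Proof.
move=> Fd F1d; set t := last_coord x => Ft1 F0 Fv vF p2 pmax.
have [_ kn] := andP hk.
have le_hess : F t ^+ 3 - F t <= truncated_laplacian k (hessian phi x).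
  apply: (truncated_laplacian_ge (j := ord_max)); rewrite ?hessian_sym ?(leqW kn) //.
    suff : 0 <= F t * ((1 - F t) * (1 + F t)) by lra.
    move: Ft1; rewrite ltr_norml => /andP[? ?]; rewrite !mulr_ge0 //; lra.
  move=> w; apply: (second_order_max (t := t) p2 Fd (F1d t)).
  have := near_line w pmax; apply: filterS => s /=.
  rewrite last_coord_line -/t vF; apply: le_trans.
  by rewrite lerB.
rewrite /equation_lhs vF; lra.
Qed.

(** Along these axes the function is constant, so [phi] itself has a local maximum at [x]. *)
Lemma supersolution_tangential v phi x :
  class_C2 phi -> local_min_at (fun y => v (last_coord y) - phi y) x ->
  forall i, i != ord_max -> hessian phi x i i <= 0.
Proof.
move=> p2 pmin i iN; rewrite -quadratic_coord -[leRHS](mul0r (0 ^+ 2)).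
pose c := v (last_coord x).
apply: (@second_order_min _ _ phi x _ (fun=> c) (fun=> 0) 0 0 0) => //; last first.
  have := near_line (e i) pmin; apply: filterS => s /=.
  by rewrite last_coordD (negPf iN) mulr0 addr0.
Qed.

(** Contact from below with a maximum does not pass to a branch lying under it, whence the equality
    of [v] and [F] near the point. Comparing along the last axis suffices, as the tangential entries
    are nonpositive. *)
Lemma supersolution_touch F F1 v phi x :
  (forall t, is_derive t (1 : R) F (F1 t)) ->
  (forall t, is_derive t (1 : R) F1 (F t ^+ 3 - F t)) ->
  (\forall s \near last_coord x, v s = F s) ->
  class_C2 phi -> local_min_at (fun y => v (last_coord y) - phi y) x ->
  equation_lhs k (hessian phi x) (v (last_coord x)) <= 0.
Proof.
move=> Fd F1d vF p2 pmin; set t := last_coord x in vF *.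
have vFt : v t = F t := nbhs_singleton vF.
have hess_le : hessian phi x ord_max ord_max <= F t ^+ 3 - F t.
  rewrite -quadratic_coord -[leRHS]mulr1 -[X in _ <= _ * X](expr1n _ 2).
  apply: (second_order_min (t := t) p2 Fd (F1d t)).
  have H1 := near_line (e ord_max) pmin; have H2 := near_line (e ord_max) (near_last vF).
  near=> s; have /= : v (last_coord x) - phi x <=
      v (last_coord (x + s *: e ord_max)) - phi (x + s *: e ord_max) by near: s.
  have -> : v (last_coord (x + s *: e ord_max)) = F (last_coord (x + s *: e ord_max)).
    by near: s.
  by rewrite last_coordD eqxx -/t vFt.
have := truncated_laplacian_normal hk (hessian_sym x p2) (supersolution_tangential p2 pmin).
rewrite /equation_lhs vFt; lra.
Unshelve. all: by end_near. Qed.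

(* A maximum of two solutions of [F'' = F ^ 3 - F] has convex kinks, where no
   test function touches from above; as the maximum vanishes there, the
   directions orthogonal to [x_N] suffice for the supersolution property. *)
Lemma max_viscosity_solution (A A1 B B1 : R -> R) :
  (forall t, is_derive t (1 : R) A (A1 t)) ->
  (forall t, is_derive t (1 : R) A1 (A t ^+ 3 - A t)) ->
  (forall t, is_derive t (1 : R) B (B1 t)) ->
  (forall t, is_derive t (1 : R) B1 (B t ^+ 3 - B t)) ->
  (forall t, `|A t| < 1) -> (forall t, `|B t| < 1) ->
  (forall t, 0 <= Num.max (A t) (B t)) ->
  (forall t, A t = B t -> A t = 0) ->
  viscosity_solution k
    (fun x : 'rV[R]_n.+2 => Num.max (A (last_coord x)) (B (last_coord x))).
Proof.
move=> Ad A1d Bd B1d Abd Bbd AB0 ABE; pose v t := Num.max (A t) (B t).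
have Ac := is_derive_continuous Ad; have Bc := is_derive_continuous Bd.
have vc : continuous v by move=> t; apply: (@continuous_max _ _ A B); [exact: Ac | exact: Bc].
have uc : continuous (v \o @last_coord R n.+1).
  by move=> x; apply: continuous_comp; [exact: last_coord_continuous | exact: vc].
have vbd t : `|v t| < 1 by rewrite /v /Num.max; case: ifP.
split; split=> [|x|phi x p2 ext].
- exact: (continuous_usc uc).
- exact: vbd.
- have [BA|AB] := leP (B (last_coord x)) (A (last_coord x)).
    have vA : v (last_coord x) = A (last_coord x) by rewrite /v max_l.
    rewrite -vA; apply: (subsolution_touch Ad A1d) => // [|t].
      by rewrite -vA; exact: AB0.
    by rewrite /v le_max lexx.
  have vB : v (last_coord x) = B (last_coord x) by rewrite /v max_r // ltW.
  rewrite -vB; apply: (subsolution_touch Bd B1d) => // [|t].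
    by rewrite -vB; exact: AB0.
  by rewrite /v le_max lexx orbT.
- exact: (continuous_lsc uc).
- exact: vbd.
- have [AB|BA|AB] := ltgtP (A (last_coord x)) (B (last_coord x)).
  + have H : \forall t \near last_coord x, v t = B t.
      have BAc : B t - A t @[t --> last_coord x] --> B (last_coord x) - A (last_coord x).
        by apply: cvgB; [exact: Bc | exact: Ac].
      rewrite -subr_gt0 in AB; have BA : \forall t \near last_coord x, 0 < B t - A t by exact: cvgr_gt BAc _ AB.
      by apply: filterS BA => t; rewrite subr_gt0 => /ltW ?; rewrite /v max_r.
    by have := supersolution_touch Bd B1d H p2 ext; rewrite /v max_r // ltW.
  + have H : \forall t \near last_coord x, v t = A t.
      have ABc : A t - B t @[t --> last_coord x] --> A (last_coord x) - B (last_coord x).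
        by apply: cvgB; [exact: Ac | exact: Bc].
      rewrite -subr_gt0 in BA; have AB : \forall t \near last_coord x, 0 < A t - B t by exact: cvgr_gt ABc _ BA.
      by apply: filterS AB => t; rewrite subr_gt0 => /ltW ?; rewrite /v max_l.
    by have := supersolution_touch Ad A1d H p2 ext; rewrite /v max_l // ltW.
  + rewrite ABE // /equation_lhs expr0n subr0 addr0.
    have [_ kn] := andP hk.
    exact: truncated_laplacian_tangential kn (hessian_sym x p2)
      (@supersolution_tangential v phi x p2 ext).
Qed.

End MaxSolution.

(** * The hyperbolic tangent profile *)

Section TanhProfile.
Variable R : realType.
Local Notation c := (Num.sqrt 2 : R).

(** Decreasing, because of the positive exponent. It solves a logistic equation, so the derivatives
    of the profile are polynomials in it. *)
Definition logistic (t : R) : R := (1 + expR (c * t))^-1.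

(* [tanh (t / sqrt 2)] *)
Definition tanh_profile (t : R) : R := 1 - 2 * logistic t.

Let E0 t : 0 < 1 + expR (c * t).
Proof. by rewrite ltr_wpDl // expR_gt0. Qed.

Lemma is_derive_logistic t :
  is_derive t (1 : R) logistic (- c * (logistic t - logistic t ^+ 2)).
Proof.
have Ed : is_derive t (1 : R) (fun s => 1 + expR (c * s)) (c * expR (c * t)).
  have d := @is_derive1_comp _ expR (fun s => c * s) t _ _
    (is_derive_expR _) (is_derive_mull c (is_derive_id t (1 : R))).
  apply: is_derive_eq (is_deriveD (is_derive_cst (1 : R) t 1) d) _.
  by rewrite mulr1 add0r mulrC.
have EN0 : 1 + expR (c * t) != 0 by rewrite gt_eqF.
case: Ed => dE dEE; split; first exact: derivableV.
rewrite deriveV // dEE /logistic /GRing.scale /=; field.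
by [].
Qed.

Lemma is_derive_tanh_profile t :
  is_derive t (1 : R) tanh_profile (2 * c * (logistic t - logistic t ^+ 2)).
Proof.
have d := is_derive_mull 2 (is_derive_logistic t).
apply: is_derive_eq (is_deriveB (is_derive_cst (1 : R) t 1) d) _.
by rewrite sub0r; ring.
Qed.

Lemma is_derive2_tanh_profile t :
  is_derive t (1 : R) (fun t => 2 * c * (logistic t - logistic t ^+ 2))
    (tanh_profile t ^+ 3 - tanh_profile t).
Proof.
have d := is_derive_logistic t.
apply: is_derive_eq (is_derive_mull (2 * c) (is_deriveB d (is_deriveX 2 d))) _.
have c2 : c ^+ 2 = 2 by rewrite sqr_sqrtr.
rewrite /tanh_profile /GRing.scale /=; set q := logistic t.
(* With [T = 1 - 2 * q], [T ^+ 3 - T] is [- 4] times the same product, which is why the scaling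
   satisfies [c ^+ 2 = 2]. *)
transitivity (- 2 * c ^+ 2 * ((1 - 2 * q) * (q - q ^+ 2))); first by ring.
by rewrite c2; ring.
Qed.

Lemma logistic_gt0 t : 0 < logistic t.
Proof. by rewrite invr_gt0. Qed.

Lemma logisticN t : logistic (- t) = 1 - logistic t.
Proof.
rewrite /logistic mulrN expRN; have := E0 t; have := expR_gt0 (c * t).
by move=> e0 e1; field; rewrite !gt_eqF.
Qed.

Lemma tanh_profileN t : tanh_profile (- t) = - tanh_profile t.
Proof. by rewrite /tanh_profile logisticN; ring. Qed.

Lemma tanh_profile_bound t : `|tanh_profile t| < 1.
Proof.
have := logistic_gt0 t; have := logistic_gt0 (- t); rewrite logisticN.
by rewrite ltr_norml /tanh_profile => ? ?; apply/andP; split; lra.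
Qed.

Lemma tanh_profile_ge0 t : 0 <= t -> 0 <= tanh_profile t.
Proof.
move=> t0; have := logistic_gt0 t.
have : logistic t <= 2^-1.
  rewrite lef_pV2 ?posrE // -[leLHS]/(1 + 1) lerD2l -[leLHS](@expR0 R) ler_expR.
  by rewrite mulr_ge0 ?sqrtr_ge0.
rewrite /tanh_profile; lra.
Qed.

Lemma tanh_profile1 : tanh_profile 1 != 0.
Proof.
rewrite gt_eqF // /tanh_profile.
suff : logistic 1 < 2^-1 by lra.
rewrite ltf_pV2 ?posrE // -[ltLHS]/(1 + 1) ltrD2l -[ltLHS](@expR0 R) ltr_expR.
by rewrite mulr1 sqrtr_gt0.
Qed.

Lemma cvg_tanh_profile : tanh_profile t @[t --> +oo] --> (1 : R).
Proof.
have q0 : logistic t @[t --> +oo] --> (0 : R).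
  (* Since [1 <= c], the logistic function is at most [expR (- t)] for nonnegative [t]. *)
  apply: squeeze_cvgr (cvg_cst 0) (@cvgr_expR R); near=> t.
  have t0 : 0 <= t by near: t; exact: nbhs_pinfty_ge.
  rewrite (ltW (logistic_gt0 t)) expRN lef_pV2 ?posrE ?expR_gt0 //=.
  rewrite (@le_trans _ _ (expR (c * t))) ?lerDr ?ler01 // ler_expR ler_peMl //.
  by rewrite -[leLHS]sqrtr1 ler_sqrt // ler1n.
have -> : (1 : R) = 1 - 2 * 0 by rewrite mulr0 subr0.
by apply: cvgB; [exact: cvg_cst | exact: cvgMl_tmp].
Unshelve. all: by end_near. Qed.

End TanhProfile.

(** * The two nontrivial solutions and the final statement *)

Lemma heteroclinic_solution (R : realType) n k : (1 <= k <= n.+1)%N ->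
  exists (u : 'rV[R]_n.+2 -> R) (v : R -> R),
    [/\ forall x, u x = v (last_coord x), exists x, u x != 0,
        viscosity_solution k u,
        v t @[t --> -oo] --> (0 : R) & v t @[t --> +oo] --> (1 : R)].
Proof.
move=> hk; pose T := @tanh_profile R; pose v t := Num.max (T t) 0.
have v_pos t : 0 <= t -> v t = T t by move=> t0; rewrite /v max_l ?tanh_profile_ge0.
exists (fun x => v (last_coord x)), v; split=> //.
- exists (1 *: delta_mx ord0 ord_max).
  by rewrite last_coord_axis v_pos ?ler01 // tanh_profile1.
- have zero_derive t : is_derive t (1 : R) (fun=> 0 : R) (0 : R) by exact: is_derive_cst.
  apply: (max_viscosity_solution hk (@is_derive_tanh_profile R)
    (@is_derive2_tanh_profile R) zero_derive).
  + by move=> t; rewrite expr0n subrr.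
  + exact: tanh_profile_bound.
  + by move=> t; rewrite normr0.
  + by move=> t; rewrite le_max lexx orbT.
  + by [].
- apply: cvg_near_cst; near=> t.
  have t0 : t < 0 by near: t; exact: nbhs_ninfty_lt.
  rewrite /v max_r // -[t]opprK /T tanh_profileN oppr_le0 tanh_profile_ge0 //.
  by rewrite oppr_ge0 ltW.
- apply: cvg_trans (@cvg_tanh_profile R); apply: near_eq_cvg; near=> t.
  by rewrite v_pos //; near: t; exact: nbhs_pinfty_ge.
Unshelve. all: by end_near. Qed.

Lemma homoclinic_solution (R : realType) n k : (1 <= k <= n.+1)%N ->
  exists (u : 'rV[R]_n.+2 -> R) (v : R -> R),
    [/\ forall x, u x = v (last_coord x), exists x, u x != 0,
        viscosity_solution k u,
        v t @[t --> -oo] --> (1 : R) & v t @[t --> +oo] --> (1 : R)].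
Proof.
move=> hk; pose T := @tanh_profile R; pose v t := Num.max (T t) (- T t).
have vN t : v (- t) = v t by rewrite /v /T tanh_profileN opprK maxC.
have v_pos t : 0 <= t -> v t = T t.
  move=> t0; have T0 : 0 <= T t by exact: tanh_profile_ge0.
  by rewrite /v max_l // ge0_cp.
have v_lim : v t @[t --> +oo] --> (1 : R).
  apply: cvg_trans (@cvg_tanh_profile R); apply: near_eq_cvg; near=> t.
  by rewrite v_pos //; near: t; exact: nbhs_pinfty_ge.
exists (fun x => v (last_coord x)), v; split=> //.
- exists (1 *: delta_mx ord0 ord_max).
  by rewrite last_coord_axis v_pos ?ler01 // tanh_profile1.
- pose T1 t : R := 2 * Num.sqrt 2 * (logistic t - logistic t ^+ 2).
  (* The equation is odd, so [- T] is the second branch. *)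
  have Td t : is_derive t (1 : R) (fun s => - T s) (- T1 t).
    exact: is_deriveN (is_derive_tanh_profile t).
  have T1d t : is_derive t (1 : R) (fun s => - T1 s) ((- T t) ^+ 3 - - T t).
    by apply: is_derive_eq (is_deriveN (is_derive2_tanh_profile t)) _; rewrite /T; ring.
  apply: (max_viscosity_solution hk (@is_derive_tanh_profile R)
    (@is_derive2_tanh_profile R) Td T1d).
  + exact: tanh_profile_bound.
  + by move=> t; rewrite normrN tanh_profile_bound.
  + by move=> t; rewrite le_max oppr_ge0 le_total.
  + by move=> t; rewrite -/(T t) => E; lra.
- rewrite cvgNy_compNP; have -> // : v \o -%R = v by apply/funext => t; exact: vN.
Unshelve. all: by end_near. Qed.

Unset Implicit Arguments.

Theorem proposition1 (R : realType) (n k : nat) (hk : (1 <= k <= n.+1)%N) :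
  (* the dimension is N = n.+2 *)
  [/\ (* (i) *)
      forall u : 'rV[R]_n.+2 -> R,
        usc u -> one_dimensional u -> viscosity_subsolution k u ->
        forall x, 0 <= u x,
      (* (ii) *)
      forall u : 'rV[R]_n.+2 -> R,
        (one_dimensional u /\ classical_solution k u) <-> (forall x, u x = 0),
      (* (iii) *)
      (exists (u : 'rV[R]_n.+2 -> R) (v : R -> R),
         [/\ forall x, u x = v (last_coord x),
             exists x, u x != 0,
             viscosity_solution k u,
             v t @[t --> -oo] --> (0 : R)
           & v t @[t --> +oo] --> (1 : R)]) /\
      (exists (u : 'rV[R]_n.+2 -> R) (v : R -> R),
         [/\ forall x, u x = v (last_coord x),
             exists x, u x != 0,
             viscosity_solution k u,
             v t @[t --> -oo] --> (1 : R)
           & v t @[t --> +oo] --> (1 : R)]),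
      (* (iv) *)
      ~ (exists u : 'rV[R]_n.+2 -> R,
           [/\ one_dimensional u, viscosity_supersolution k u
             & forall x, 0 < u x])
    & (* (v) *)
      forall (u : 'rV[R]_n.+2 -> R) (v : R -> R),
        (forall x, u x = v (last_coord x)) -> (forall x, 0 <= u x) ->
        viscosity_supersolution k u -> {homo v : s t / s <= t} ->
        exists t0 : R, forall x, last_coord x <= t0 -> u x = 0].
Proof.
split.
- move=> u _ [v uv] usub x; rewrite uv.
  exact: (subsolution_ge0 hk uv usub).
- move=> u; split=> [[u1 usol] x|]; first exact: (classical_eq0 hk u1 usol).
  exact: zero_classical_solution.
- by split; [exact: heteroclinic_solution | exact: homoclinic_solution].
- move=> [u [[v uv] usup u0]]; have [ulsc ubd _] := usup.
  have axis t : v t = u (t *: delta_mx ord0 ord_max) by rewrite uv last_coord_axis.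
  apply: (affine_touch_not_positive (lsc1_last uv ulsc) _
    (supersolution_affine_touch hk uv usup)) => t; rewrite axis //.
- move=> u v uv u0 usup v_homo; have [ulsc ubd _] := usup.
  have axis t : v t = u (t *: delta_mx ord0 ord_max) by rewrite uv last_coord_axis.
  have vbd t : `|v t| < 1 by rewrite axis.
  (* Any point where [v] fails to be positive serves as [t0]; monotonicity and nonnegativity then
     give zero to its left. *)
  have /existsNP[t0 /negP] := affine_touch_not_positive (lsc1_last uv ulsc) vbd
    (supersolution_affine_touch hk uv usup).
  rewrite -leNgt => vt0; exists t0 => x xt0; apply/eqP.
  by rewrite eq_le u0 andbT uv (le_trans (v_homo _ _ xt0)).
Qed.
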